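(* Consider the energy-limited single-loop problem defined in the context. When the energy transfer power $P_0$ is very small such that the uplink and downlink lie in the low-SNR regime (i.e. the SNRs $\gamma^{\mathrm u}$ and $\gamma^{\mathrm d}$ defined in the context are small), the optimal energy allocation approximately satisfies $$E^{\mathrm u}:E^{\mathrm d}\approx\frac{1}{\rho g^{\mathrm u}}:\frac{1}{g^{\mathrm d}}.$$ In addition, the optimal time allocation satisfies $$t^{\mathrm u}:t^{\mathrm d}\approx\frac{1}{\rho\sqrt{\eta^{\mathrm s}g^{\mathrm u}}}:\frac{1}{\sqrt{\eta^{\mathrm e}g^{\mathrm d}}}.$$
   Context: The constants $g^{\mathrm u},g^{\mathrm d}$ (channel gains), $N_0$ (noise power spectral density), $B_{\max}$ (bandwidth), $\alpha$ (CPU cycles per bit), $\kappa$ (computation energy coefficient), $\eta^{\mathrm s},\eta^{\mathrm e}$ (energy transfer efficiencies), $P_0$ (maximum energy transfer power), $T$ (cycle time) are positive reals, and $\rho\in(0,1)$. The energy-limited single-loop problem, in which energy is the bottleneck and the sensing-data, peak-transmit-power and peak-CPU-frequency constraints are omitted, has variables $D$ and the energies and times $E^{\mathrm u},E^{\mathrm c},E^{\mathrm d},t^{\mathrm u},t^{\mathrm c},t^{\mathrm d}$ of the uplink, computing and downlink stages, and reads: maximize $D$ subject to $D\le\rho t^{\mathrm u}B_{\max}\log_2\left(1+\frac{g^{\mathrm u}E^{\mathrm u}}{t^{\mathrm u}B_{\max}N_0}\right)$; $D\le\rho t^{\mathrm c}\left(\frac{E^{\mathrm c}}{\alpha^3\kappa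 t^{\mathrm c}}\right)^{1/3}$; $D\le t^{\mathrm d}B_{\max}\log_2\left(1+\frac{g^{\mathrm d}E^{\mathrm d}}{t^{\mathrm d}B_{\max}N_0}\right)$; $t^{\mathrm u}+t^{\mathrm c}+t^{\mathrm d}\le T$; $\frac{E^{\mathrm u}}{\eta^{\mathrm s}}+\frac{E^{\mathrm c}+E^{\mathrm d}}{\eta^{\mathrm e}}\le P_0T$. The uplink and downlink signal-to-noise ratios (SNRs) are $\gamma^{\mathrm u}=\frac{g^{\mathrm u}E^{\mathrm u}}{B_{\max}N_0t^{\mathrm u}}$ and $\gamma^{\mathrm d}=\frac{g^{\mathrm d}E^{\mathrm d}}{B_{\max}N_0t^{\mathrm d}}$. The symbol $\approx$ is used informally: it denotes the approximation obtained by replacing functions of the SNRs by their leading-order Taylor expansions at small SNR. *)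

(* Defs.v *)
From HB Require Import structures.
From mathcomp Require Import all_boot all_order all_algebra.
From mathcomp Require Import all_classical all_reals all_analysis.

Set Implicit Arguments.
Unset Strict Implicit.
Unset Printing Implicit Defensive.

Import Order.TTheory GRing.Theory Num.Theory.
Import numFieldNormedType.Exports.
Local Open Scope classical_set_scope.
Local Open Scope ring_scope.

(* The transfer power [P0] is not a field: it is the quantity that is made
   small while all the other constants stay fixed. *)
Record constants (R : realType) := Constants {
  g_u : R;    (* uplink channel gain *)
  g_d : R;    (* downlink channel gain *)
  N0 : R;     (* noise power spectral density *)
  Bmax : R;   (* bandwidth *)
  alpha : R;  (* CPU cycles per bit *)
  kappa : R;  (* computation energy coefficient *)
  eta_s : R;  (* energy transfer efficiency, uplink budget *)
  eta_e : R;  (* energy transfer efficiency, computing and downlink budget *)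
  Tcyc : R;   (* cycle time *)
  rho : R
}.

Record admissible (R : realType) (c : constants R) : Prop := Admissible {
  g_u_gt0 : 0 < g_u c;
  g_d_gt0 : 0 < g_d c;
  N0_gt0 : 0 < N0 c;
  Bmax_gt0 : 0 < Bmax c;
  alpha_gt0 : 0 < alpha c;
  kappa_gt0 : 0 < kappa c;
  eta_s_gt0 : 0 < eta_s c;
  eta_e_gt0 : 0 < eta_e c;
  Tcyc_gt0 : 0 < Tcyc c;
  rho_gt0 : 0 < rho c;
  rho_lt1 : rho c < 1
}.

Record allocation (R : realType) := Allocation {
  D : R;
  E_u : R;
  E_c : R;
  E_d : R;
  t_u : R;
  t_c : R;
  t_d : R
}.

Definition log2 (R : realType) (x : R) : R := ln x / ln 2.

Definition snr_u (R : realType) (c : constants R) (x : allocation R) : R :=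
  g_u c * E_u x / (Bmax c * N0 c * t_u x).

Definition snr_d (R : realType) (c : constants R) (x : allocation R) : R :=
  g_d c * E_d x / (Bmax c * N0 c * t_d x).

(* Energies are nonnegative and times positive, so that every logarithm,
   cube root and quotient below has its usual meaning. *)
Record feasible (R : realType) (c : constants R) (P0 : R) (x : allocation R) :
    Prop := Feasible {
  E_u_ge0 : 0 <= E_u x;
  E_c_ge0 : 0 <= E_c x;
  E_d_ge0 : 0 <= E_d x;
  t_u_gt0 : 0 < t_u x;
  t_c_gt0 : 0 < t_c x;
  t_d_gt0 : 0 < t_d x;
  uplink_rate :
    D x <= rho c * t_u x * Bmax c *
           log2 (1 + g_u c * E_u x / (t_u x * Bmax c * N0 c));
  computing_rate :
    D x <= rho c * t_c x *
           (E_c x / (alpha c ^+ 3 * kappa c * t_c x)) `^ (3^-1);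
  downlink_rate :
    D x <= t_d x * Bmax c *
           log2 (1 + g_d c * E_d x / (t_d x * Bmax c * N0 c));
  time_budget : t_u x + t_c x + t_d x <= Tcyc c;
  energy_budget :
    E_u x / eta_s c + (E_c x + E_d x) / eta_e c <= P0 * Tcyc c
}.

Definition optimal (R : realType) (c : constants R) (P0 : R)
    (x : allocation R) : Prop :=
  feasible c P0 x /\ forall y, feasible c P0 y -> D y <= D x.

(* [a : b] and [a' : b'] agree up to a relative error smaller than [e]. *)
Definition same_ratio_upto (R : realType) (e a b a' b' : R) : Prop :=
  `|(a / b) / (a' / b') - 1| < e.

(* Main.v *)
(* For fixed times, carrying D costs a least energy W(D, t), whose uplink and
   downlink terms are p t (e^y - 1) with y = q D / t.  Since W is continuous in
   D, an optimum attains W(D, t) = P0 T and its times minimise W(D, .): hence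
   the SNRs are exactly e^y - 1, and p M(y), with M(y) = 1 - e^y + y e^y, takes
   the same value on both links.  Both ratios then follow from
   1 <= (e^y - 1) / y <= e^y and 1 <= 2 M(y) / y^2 <= e^y, where
   e^y = 1 + SNR; the time ratio is the square root of a ratio of M's.
   The SNRs tend to 0 with P0 because W(D, t) >= D (A + c y) for a constant A,
   while equal times already cost only D (A + o(1)). *)

Require Import Defs.
From HB Require Import structures.
From mathcomp Require Import all_boot all_order all_algebra.
From mathcomp Require Import all_classical all_reals all_analysis.
From mathcomp Require Import ring lra.
Set Implicit Arguments.
Unset Strict Implicit.
Unset Printing Implicit Defensive.
Import Order.TTheory GRing.Theory Num.Theory.
Import numFieldNormedType.Exports.
Local Open Scope classical_set_scope.
Local Open Scope ring_scope.

(** * Inversion of the rate functions *)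

Lemma ln2_gt0 (R : realType) : 0 < ln 2 :> R.
Proof. by rewrite ln_gt0// ltr1n. Qed.

Lemma le_rate (R : realType) (r z D : R) : 0 < r -> 0 <= z ->
  (D <= r * log2 (1 + z)) = (expR (ln 2 * D / r) - 1 <= z).
Proof.
move=> r0 z0; have l0 := @ln2_gt0 R.
have z1 : 1 + z \is Num.pos by rewrite posrE; lra.
rewrite lerBlDl -[in RHS](lnK z1).
rewrite ler_expR /log2 ler_pdivrMr// mulrA ler_pdivlMr//.
by rewrite (mulrC D) (mulrC (ln _) r).
Qed.

Lemma le_cube_root (R : realType) (r z D : R) : 0 < r -> 0 <= z -> 0 <= D ->
  (D <= r * z `^ 3^-1) = ((D / r) ^+ 3 <= z).
Proof.
move=> r0 z0 D0; rewrite mulrC -ler_pdivrMr//.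
have zE : (z `^ 3^-1) ^+ 3 = z.
  by rewrite -powR_mulrn ?powR_ge0// -powRrM mulVf ?powRr1// pnatr_eq0.
by rewrite -[in RHS]zE ler_pXn2r// nnegrE ?powR_ge0// divr_ge0// ltW.
Qed.

(** * Least energy needed to carry a given [D] *)

Definition stage_energy (R : realType) (p q D t : R) : R :=
  p * t * (expR (q * D / t) - 1).

(* Energy drawn from the budget per unit of time and of SNR. *)
Definition snr_cost_u (R : realType) (c : constants R) : R :=
  Bmax c * N0 c / (g_u c * eta_s c).

Definition snr_cost_d (R : realType) (c : constants R) : R :=
  Bmax c * N0 c / (g_d c * eta_e c).

(* Carrying [D] in time [t] needs the SNR [expR (nats * D / t) - 1]. *)
Definition nats_u (R : realType) (c : constants R) : R :=
  ln 2 / (rho c * Bmax c).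

Definition nats_d (R : realType) (c : constants R) : R := ln 2 / Bmax c.

(** Obtained by solving the cube-root rate for [E_c] and dividing by [eta_e]. *)
Definition cpu_cost (R : realType) (c : constants R) : R :=
  alpha c ^+ 3 * kappa c / (rho c ^+ 3 * eta_e c).

(** The cost [W(D, t)], with every energy already divided by its transfer efficiency. *)
Definition min_energy (R : realType) (c : constants R) (D tu tc td : R) : R :=
  stage_energy (snr_cost_u c) (nats_u c) D tu + cpu_cost c * D ^+ 3 / tc ^+ 2
  + stage_energy (snr_cost_d c) (nats_d c) D td.

Lemma constants_gt0 (R : realType) (c : constants R) : admissible c ->
  [/\ 0 < snr_cost_u c, 0 < snr_cost_d c, 0 < nats_u c, 0 < nats_d c
    & 0 < cpu_cost c].
Proof.
case=> *; have l0 := @ln2_gt0 R.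
by split; rewrite divr_gt0 ?mulr_gt0 ?exprn_gt0.
Qed.

(** Solving each rate constraint for its SNR or energy makes the budget comparable with [min_energy]
    term by term. *)
Lemma feasible_energy_ge (R : realType) (c : constants R) (P0 : R)
    (x : allocation R) : admissible c -> feasible c P0 x -> 0 <= D x ->
  [/\ expR (nats_u c * D x / t_u x) - 1 <= snr_u c x,
      expR (nats_d c * D x / t_d x) - 1 <= snr_d c x,
      E_u x / eta_s c = snr_cost_u c * t_u x * snr_u c x,
      E_d x / eta_e c = snr_cost_d c * t_d x * snr_d c x
    & cpu_cost c * D x ^+ 3 / t_c x ^+ 2 <= E_c x / eta_e c].
Proof.
case=> gu gd n0 B0 al ka es ee T0 r0 _ [Eu Ec Ed tu tc td ru rc rd _ _] D0.
have l0 := @ln2_gt0 R.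
split.
- move: ru; rewrite le_rate ?mulr_gt0//; last first.
    by rewrite divr_ge0 ?mulr_ge0// ltW.
  rewrite /snr_u /nats_u (_ : Bmax c * N0 c * t_u x = t_u x * Bmax c * N0 c)//.
    rewrite (_ : ln 2 * D x / (rho c * t_u x * Bmax c) =
               ln 2 / (rho c * Bmax c) * D x / t_u x)//.
    by field; rewrite ?gt_eqF.
  by ring.
- move: rd; rewrite le_rate ?mulr_gt0//; last first.
    by rewrite divr_ge0 ?mulr_ge0// ltW.
  rewrite /snr_d /nats_d (_ : Bmax c * N0 c * t_d x = t_d x * Bmax c * N0 c)//.
    rewrite (_ : ln 2 * D x / (t_d x * Bmax c) =
               ln 2 / Bmax c * D x / t_d x)//.
    by field; rewrite ?gt_eqF.
  by ring.
- by rewrite /snr_cost_u /snr_u; field; rewrite ?gt_eqF.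
- by rewrite /snr_cost_d /snr_d; field; rewrite ?gt_eqF.
- move: rc; rewrite le_cube_root ?mulr_gt0//; last first.
    by rewrite divr_ge0 ?mulr_ge0 ?exprn_ge0// ltW.
  rewrite ler_pdivlMr ?mulr_gt0 ?exprn_gt0// => h.
  rewrite ler_pdivlMr//; apply: le_trans h.
  rewrite le_eqVlt; apply/orP; left; apply/eqP.
  by rewrite /cpu_cost; field; rewrite ?gt_eqF.
Qed.

(** Each stage receives exactly the energy that turns its rate constraint into an equality. *)
Lemma feasible_min_energy (R : realType) (c : constants R) (P0 D' tu tc td : R) :
  admissible c -> 0 <= D' -> 0 < tu -> 0 < tc -> 0 < td ->
  tu + tc + td <= Tcyc c -> min_energy c D' tu tc td <= P0 * Tcyc c ->
  exists2 x, feasible c P0 x & D x = D'.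
Proof.
move=> hc D0 tu0 tc0 td0 sumT; have := constants_gt0 hc.
case: hc => gu gd n0 B0 al ka es ee T0 r0 _ [pu pd qu qd cc] W.
pose Eu := eta_s c * stage_energy (snr_cost_u c) (nats_u c) D' tu.
pose Ec := eta_e c * (cpu_cost c * D' ^+ 3 / tc ^+ 2).
pose Ed := eta_e c * stage_energy (snr_cost_d c) (nats_d c) D' td.
have stage_ge0 p q t : 0 < p -> 0 < q -> 0 < t -> 0 <= stage_energy p q D' t.
  move=> p0 q0 t0; apply: mulr_ge0; first by rewrite mulr_ge0// ltW.
  rewrite subr_ge0.
  have : 0 <= q * D' / t by rewrite divr_ge0 ?mulr_ge0// ltW.
  by have := expR_ge1Dx (q * D' / t); lra.
have Eu0 : 0 <= Eu by rewrite mulr_ge0 ?stage_ge0// ltW.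
have Ed0 : 0 <= Ed by rewrite mulr_ge0 ?stage_ge0// ltW.
have Ec0 : 0 <= Ec.
  apply: mulr_ge0; first exact: ltW.
  apply: divr_ge0; last by rewrite exprn_ge0// ltW.
  by apply: mulr_ge0; [exact: ltW | rewrite exprn_ge0].
have EuE : Eu = eta_s c * stage_energy (snr_cost_u c) (nats_u c) D' tu by [].
have EcE : Ec = eta_e c * (cpu_cost c * D' ^+ 3 / tc ^+ 2) by [].
have EdE : Ed = eta_e c * stage_energy (snr_cost_d c) (nats_d c) D' td by [].
clearbody Eu Ec Ed.
exists (Allocation D' Eu Ec Ed tu tc td) => //; split=> //=.
- rewrite le_rate ?mulr_gt0//; last by rewrite divr_ge0 ?mulr_ge0// ltW.
  rewrite le_eqVlt; apply/orP; left; apply/eqP.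
  rewrite EuE /stage_energy /snr_cost_u /nats_u.
  rewrite (_ : ln 2 * D' / (rho c * tu * Bmax c) =
               ln 2 / (rho c * Bmax c) * D' / tu).
    by field; rewrite ?gt_eqF.
  by field; rewrite ?gt_eqF.
- rewrite le_cube_root ?mulr_gt0//; last first.
    by rewrite divr_ge0 ?mulr_ge0 ?exprn_ge0// ltW.
  rewrite le_eqVlt; apply/orP; left; apply/eqP.
  by rewrite EcE /cpu_cost; field; rewrite ?gt_eqF.
- rewrite le_rate ?mulr_gt0//; last by rewrite divr_ge0 ?mulr_ge0// ltW.
  rewrite le_eqVlt; apply/orP; left; apply/eqP.
  rewrite EdE /stage_energy /snr_cost_d /nats_d.
  rewrite (_ : ln 2 * D' / (td * Bmax c) = ln 2 / Bmax c * D' / td).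
    by field; rewrite ?gt_eqF.
  by field; rewrite ?gt_eqF.
- apply: le_trans W; rewrite le_eqVlt; apply/orP; left; apply/eqP.
  by rewrite /min_energy EuE EcE EdE; field; rewrite ?gt_eqF.
Qed.

(** * Energy surplus and growth of [D] *)

Lemma continuous_min_energy (R : realType) (c : constants R) (tu tc td : R) :
  continuous (fun D' => min_energy c D' tu tc td).
Proof.
move=> z; rewrite /min_energy /stage_energy.
have lin (q t : R) : (fun D' : R => q * D' / t) @ z --> q * z / t.
  by apply: cvgMl; apply: cvgMr; exact: cvg_id.
have stage p q t : (fun D' : R => p * t * (expR (q * D' / t) - 1)) @ z -->
    p * t * (expR (q * z / t) - 1).
  apply: cvgMr; apply: cvgB; last exact: cvg_cst.
  by apply: continuous_cvg (lin q t); exact: continuous_expR.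
apply: cvgD; last exact: stage.
apply: cvgD; first exact: stage.
apply: cvgMl; apply: cvgMr; exact: exprn_continuous.
Qed.

(** By continuity of [min_energy] in [D], a strict surplus still pays for some [D2 > D'], which the
    optimum must reach. *)
Lemma optimal_gt (R : realType) (c : constants R) (P0 D' tu tc td : R)
    (x : allocation R) : admissible c -> optimal c P0 x ->
  0 <= D' -> 0 < tu -> 0 < tc -> 0 < td -> tu + tc + td <= Tcyc c ->
  min_energy c D' tu tc td < P0 * Tcyc c -> D' < D x.
Proof.
move=> hc [_ xmax] D0 tu0 tc0 td0 sumT W.
have cvW : min_energy c D2 tu tc td @[D2 --> D'^'+]
    --> min_energy c D' tu tc td.
  by apply: cvg_at_right_filter; exact: continuous_min_energy.
have nearW : \forall D2 \near D'^'+,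
    min_energy c D2 tu tc td < P0 * Tcyc c /\ D' < D2.
  by apply: filterI; [exact: (cvgr_lt _ cvW) | exact: nbhs_right_gt].
have [D2 [W2 lt2]] := @filter_ex _ D'^'+ _ _ nearW.
have D20 : 0 <= D2 by rewrite (le_trans D0)// ltW.
have [y fy Dy] := feasible_min_energy hc D20 tu0 tc0 td0 sumT (ltW W2).
by rewrite (lt_le_trans lt2)// -Dy xmax.
Qed.

(** * Exponential inequalities replacing Taylor expansions *)

Lemma expR_subr1_le (R : realType) (y : R) : expR y - 1 <= y * expR y.
Proof.
have : (1 - y) * expR y <= expR (- y) * expR y.
  by rewrite ler_pM2r ?expR_gt0//; exact: expR_ge1Dx.
by rewrite (mulrC (expR (- y))) expRxMexpNx_1; lra.
Qed.

(** Square [1 + y / 2 <= expR (y / 2)]. The quadratic term is what later forces the SNRs down. *)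
Lemma expR_subr1_ge_quad (R : realType) (y : R) :
  0 <= y -> y * (1 + y / 4) <= expR y - 1.
Proof.
move=> y0; have h : 1 + y / 2 <= expR (y / 2) by exact: expR_ge1Dx.
have -> : expR y = expR (y / 2) ^+ 2 by rewrite -expRM_natl; congr expR; field.
by nra.
Qed.

Lemma ge0_derive_ge0 (R : realType) (f df : R -> R) (y : R) :
  (forall x : R, is_derive x (1 : R) f (df x)) -> (forall x, 0 <= x -> 0 <= df x) ->
  f 0 = 0 -> 0 <= y -> 0 <= f y.
Proof.
move=> fdf df0 f0 y0.
have cf : {within `[0, y], continuous f}.
  apply: continuous_subspaceT => x; apply/differentiable_continuous.
  by apply/derivable1_diffP; have := fdf x; case.
have [z] := MVT_segment y0 (fun x _ => fdf x) cf.
rewrite f0 !subr0 in_itv/= => /andP[z0 _] ->.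
by rewrite mulr_ge0// df0.
Qed.

(** The difference of the sides vanishes at 0 and has derivative [x * (expR x - 1)]. *)
Lemma quad_le_marginal (R : realType) (y : R) :
  0 <= y -> y ^+ 2 / 2 <= 1 - expR y + y * expR y.
Proof.
move=> y0; rewrite -subr_ge0.
pose f (x : R) := 1 - expR x + x * expR x - x ^+ 2 / 2.
apply: (@ge0_derive_ge0 _ f (fun x => x * expR x - x)) => //.
- move=> x; rewrite /f; apply: is_derive_eq.
  by rewrite /GRing.scale/=; field.
- move=> x x0; have := expR_ge1Dx x; nra.
- by rewrite /f expR0; ring.
Qed.

(** After multiplication by [expR (- y)] the difference of the sides is [f], which vanishes at 0 and
    increases because [1 - x <= expR (- x)]. *)
Lemma marginal_le_quad (R : realType) (y : R) :
  0 <= y -> 1 - expR y + y * expR y <= y ^+ 2 / 2 * expR y.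
Proof.
move=> y0.
pose f (x : R) := x ^+ 2 / 2 + 1 - x - expR (- x).
have : 0 <= f y.
  apply: (@ge0_derive_ge0 _ f (fun x => x - 1 + expR (- x))) => //.
  - move=> x; rewrite /f; apply: is_derive_eq.
    by rewrite /GRing.scale/=; field.
  - by move=> x x0; have := expR_ge1Dx (- x); lra.
  - by rewrite /f oppr0 expR0; ring.
rewrite /f => fy0.
have : 0 <= f y * expR y by rewrite mulr_ge0// expR_ge0.
by rewrite /f mulrBl (mulrC (expR _)) expRxMexpNx_1; lra.
Qed.

(** * Optimality conditions *)

Lemma is_derive_stage_energy (R : realType) (p q D' t : R) : t != 0 ->
  is_derive t (1 : R) (stage_energy p q D')
    (- p * (1 - expR (q * D' / t) + q * D' / t * expR (q * D' / t))).
Proof.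
move=> t0; rewrite /stage_energy.
have dV : is_derive t (1 : R) (fun s : R => q * D' / s) (- (q * D' / t ^+ 2)).
  have dv := @is_deriveV _ id t 1 1 t0 (is_derive_id _ _).
  by apply: is_derive_eq; rewrite /GRing.scale/= mulr1 mulrN.
have dE := @is_derive1_comp _ (@expR R) (fun s => q * D' / s) _ _ _
  (is_derive_expR (q * D' / t)) dV.
apply: is_derive_eq.
by rewrite /GRing.scale/=; field.
Qed.
(** A surplus would let [D x] exceed itself, so the least energy is at least the budget. Each of its
    terms is at most the share actually spent, and these shares fit in the budget, so all are
    equalities. *)
Lemma optimal_tight (R : realType) (c : constants R) (P0 : R)
    (x : allocation R) : admissible c -> 0 < P0 -> optimal c P0 x ->
  [/\ 0 < D x,
      snr_u c x = expR (nats_u c * D x / t_u x) - 1,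
      snr_d c x = expR (nats_d c * D x / t_d x) - 1
    & min_energy c (D x) (t_u x) (t_c x) (t_d x) = P0 * Tcyc c].
Proof.
move=> hc P00 ox; have fx := ox.1.
have [pu pd qu qd cc] := constants_gt0 hc.
case: (fx) => Eu Ec Ed tu tc td _ _ _ sumT bud.
have T0 := Tcyc_gt0 hc.
have D0 : 0 < D x.
  (* [D = 0] costs no energy, so a positive [P0] is a surplus. *)
  apply: (optimal_gt hc ox _ tu tc td sumT) => //.
  rewrite /min_energy /stage_energy !mulr0 !mul0r expR0 expr0n/= mulr0 mul0r.
  by rewrite subrr !mulr0 !addr0 mulr_gt0.
have [hu hd eu ed ec] := feasible_energy_ge hc fx (ltW D0).
have W : P0 * Tcyc c <= min_energy c (D x) (t_u x) (t_c x) (t_d x).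
  rewrite leNgt; apply/negP => /(optimal_gt hc ox (ltW D0) tu tc td sumT).
  by rewrite ltxx.
rewrite mulrDl eu ed in bud.
have mu : stage_energy (snr_cost_u c) (nats_u c) (D x) (t_u x)
    <= snr_cost_u c * t_u x * snr_u c x.
  by rewrite /stage_energy ler_pM2l // mulr_gt0.
have md : stage_energy (snr_cost_d c) (nats_d c) (D x) (t_d x)
    <= snr_cost_d c * t_d x * snr_d c x.
  by rewrite /stage_energy ler_pM2l // mulr_gt0.
move: (W); rewrite /min_energy => W'.
split=> //.
- have nz : snr_cost_u c * t_u x != 0 by rewrite gt_eqF// mulr_gt0.
  apply: (mulfI nz); rewrite -/(stage_energy _ _ _ _); lra.
- have nz : snr_cost_d c * t_d x != 0 by rewrite gt_eqF// mulr_gt0.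
  apply: (mulfI nz); rewrite -/(stage_energy _ _ _ _); lra.
- by rewrite /min_energy; lra.
Qed.

(** Time is moved between the two links with [t_c] and the sum [s] fixed. The optimal split is an
    interior minimum of the link energy [f], so the derivative of [f] vanishes there. *)
Lemma optimal_stationary (R : realType) (c : constants R) (P0 : R)
    (x : allocation R) (yu := nats_u c * D x / t_u x)
    (yd := nats_d c * D x / t_d x) :
  admissible c -> 0 < P0 -> optimal c P0 x ->
  snr_cost_u c * (1 - expR yu + yu * expR yu) =
  snr_cost_d c * (1 - expR yd + yd * expR yd).
Proof.
move=> hc P00 ox; have [D0 _ _ WE] := optimal_tight hc P00 ox.
case: (ox.1) => _ _ _ tu tc td _ _ _ sumT _.
pose s := t_u x + t_d x.
pose fu := stage_energy (snr_cost_u c) (nats_u c) (D x).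
pose fd := stage_energy (snr_cost_d c) (nats_d c) (D x).
pose f t := fu t + fd (s - t).
have derf t : t != 0 -> s - t != 0 -> is_derive t (1 : R) f
    (- snr_cost_u c * (1 - expR (nats_u c * D x / t)
       + nats_u c * D x / t * expR (nats_u c * D x / t)) +
     - (- snr_cost_d c * (1 - expR (nats_d c * D x / (s - t))
       + nats_d c * D x / (s - t) * expR (nats_d c * D x / (s - t))))).
  move=> t0 st0; apply: is_deriveD; first exact: is_derive_stage_energy.
  have dl : is_derive t (1 : R) (fun u : R => s - u) (-1).
    by apply: is_derive_eq; rewrite add0r mul1r.
  have := @is_derive1_comp _ fd (fun u => s - u) _ _ _
    (is_derive_stage_energy _ _ _ st0) dl.
  by rewrite mulrN1.
have s0 : 0 <= s by rewrite addr_ge0// ltW.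
have : is_derive (t_u x) (1 : R) f 0.
  apply: (derive1_at_min s0).
  - move=> t; rewrite in_itv/= => /andP[t0 ts].
    have [] // := derf t; first by rewrite gt_eqF.
    by rewrite gt_eqF// subr_gt0.
  - by rewrite in_itv/= tu /s ltrDl.
  - move=> t; rewrite in_itv/= => /andP[t0 ts].
    rewrite leNgt; apply/negP => lt_f.
    have st0 : 0 < s - t by rewrite subr_gt0.
    have sumT' : t + t_c x + (s - t) <= Tcyc c by rewrite /s; lra.
    (* A cheaper split would leave a surplus at the same [D x]. *)
    suff : D x < D x by rewrite ltxx.
    apply: (optimal_gt hc ox (ltW D0) t0 tc st0 sumT').
    rewrite -WE /min_energy -/fu -/fd.
    by move: lt_f; rewrite /f {2}/s (addrC (t_u x)) addrK; lra.
have sE : s - t_u x = t_d x by rewrite /s addrAC subrr add0r.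
have := derf (t_u x); rewrite sE !gt_eqF// => /(_ isT isT) d1 d0.
have := derive_val (is_derive := d1).
rewrite (derive_val (is_derive := d0)) -/yu -/yd; lra.
Qed.

(** * Approximate energy and time ratios *)

Lemma ratio_near1 (R : realType) (a b d : R) :
  1 <= a < 1 + d -> 1 <= b < 1 + d -> `|a / b - 1| < d.
Proof.
move=> /andP[a1 ad] /andP[b1 bd]; have b0 : 0 < b by lra.
have -> : a / b - 1 = (a - b) / b by rewrite mulrBl divff// gt_eqF.
rewrite normrM normfV (gtr0_norm b0) ltr_pdivrMr//.
by rewrite ltr_norml; apply/andP; split; nra.
Qed.

(** The cofactor [r + 1] of [r - 1] exceeds 1. This removes the square roots from the time ratio. *)
Lemma near1_of_sqr (R : realType) (r d : R) :
  0 < r -> `|r ^+ 2 - 1| < d -> `|r - 1| < d.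
Proof.
move=> r0; apply: le_lt_trans.
have -> : r ^+ 2 - 1 = (r - 1) * (r + 1) by ring.
rewrite normrM ler_peMr// ger0_norm; lra.
Qed.

(** An SNR below [d] means [expR y < 1 + d], which puts each normalised slope and curvature in
    [[1, 1 + d)]; their quotients are then within [d] of 1. *)
Lemma optimal_ratios (R : realType) (c : constants R) (d P0 : R)
    (x : allocation R) : admissible c -> 0 < P0 -> optimal c P0 x ->
  snr_u c x < d -> snr_d c x < d ->
  same_ratio_upto d (E_u x) (E_d x) (1 / (rho c * g_u c)) (1 / g_d c) /\
  same_ratio_upto d (t_u x) (t_d x)
    (1 / (rho c * Num.sqrt (eta_s c * g_u c)))
    (1 / Num.sqrt (eta_e c * g_d c)).
Proof.
move=> hc P00 ox.
have := optimal_stationary hc P00 ox.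
have [pu pd qu qd _] := constants_gt0 hc.
case: (ox.1) => _ _ _ tu tc td _ _ _ _ _.
have [D0 + + _] := optimal_tight hc P00 ox.
set yu := nats_u c * D x / t_u x; set yd := nats_d c * D x / t_d x.
case: hc => gu gd n0 B0 al ka es ee T0 r0 _ snru snrd stat ltu ltd.
have l0 := @ln2_gt0 R.
have yu0 : 0 < yu by rewrite /yu divr_gt0// mulr_gt0.
have yd0 : 0 < yd by rewrite /yd divr_gt0// mulr_gt0.
(* Both links carry the same [D x], and [nats_u] is [nats_d] divided by [rho]. *)
have tE : t_u x / t_d x = yd / yu / rho c.
  by rewrite /yu /yd /nats_u /nats_d; field; rewrite ?gt_eqF.
have eyu : expR yu < 1 + d by move: ltu; rewrite snru; lra.
have eyd : expR yd < 1 + d by move: ltd; rewrite snrd; lra.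
have EuE : E_u x = Bmax c * N0 c * t_u x / g_u c * (expR yu - 1).
  by rewrite -snru /snr_u; field; rewrite ?gt_eqF.
have EdE : E_d x = Bmax c * N0 c * t_d x / g_d c * (expR yd - 1).
  by rewrite -snrd /snr_d; field; rewrite ?gt_eqF.
clearbody yu yd.
rewrite /same_ratio_upto; split.
- have slope (y : R) : 0 < y -> expR y < 1 + d ->
      1 <= (expR y - 1) / y < 1 + d.
    move=> y0 ey; rewrite ler_pdivlMr// ltr_pdivrMr// mul1r.
    have := expR_subr1_le y; have := expR_ge1Dx y.
    by move=> h1 h2; apply/andP; split; nra.
  have := ratio_near1 (slope _ yu0 eyu) (slope _ yd0 eyd).
  have yu1 : 0 < expR yu - 1 by rewrite subr_gt0 expR_gt1.
  have yd1 : 0 < expR yd - 1 by rewrite subr_gt0 expR_gt1.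
  (* The normalised energy ratio is exactly the quotient of the two slopes. *)
  congr (`|_ - 1| < d).
  have tuE : t_u x = yd / yu / rho c * t_d x by rewrite -tE divfK// gt_eqF.
  by rewrite EuE EdE tuE; field; rewrite ?gt_eqF.
- pose m (y : R) := 1 - expR y + y * expR y.
  have curv (y : R) : 0 < y -> expR y < 1 + d ->
      1 <= 2 * m y / y ^+ 2 < 1 + d.
    move=> y0 ey; have y20 : 0 < y ^+ 2 by rewrite exprn_gt0.
    rewrite ler_pdivlMr// ltr_pdivrMr// mul1r.
    have := quad_le_marginal (ltW y0); have := marginal_le_quad (ltW y0).
    rewrite -/(m y) => h1 h2; apply/andP; split; first lra.
    by nra.
  have m0 y : 0 < y -> 0 < m y.
    move=> y0; apply: lt_le_trans (quad_le_marginal (ltW y0)).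
    by rewrite divr_gt0// exprn_gt0.
  have su : 0 < Num.sqrt (eta_s c * g_u c) by rewrite sqrtr_gt0 mulr_gt0.
  have sd : 0 < Num.sqrt (eta_e c * g_d c) by rewrite sqrtr_gt0 mulr_gt0.
  have su2 : Num.sqrt (eta_s c * g_u c) ^+ 2 = eta_s c * g_u c.
    by rewrite sqr_sqrtr// ltW// mulr_gt0.
  have sd2 : Num.sqrt (eta_e c * g_d c) ^+ 2 = eta_e c * g_d c.
    by rewrite sqr_sqrtr// ltW// mulr_gt0.
  set Su := Num.sqrt (eta_s c * g_u c) in su su2 *.
  set Sd := Num.sqrt (eta_e c * g_d c) in sd sd2 *.
  clearbody Su Sd.
  apply: near1_of_sqr.
    by rewrite divr_gt0// !divr_gt0// mulr_gt0.
  have := ratio_near1 (curv _ yu0 eyu) (curv _ yd0 eyd).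
  (* Stationarity, with the common factor [Bmax * N0] cancelled. *)
  have mE : m yu = eta_s c * g_u c / (eta_e c * g_d c) * m yd.
    have nz : snr_cost_u c != 0 by rewrite gt_eqF.
    apply: (mulfI nz); rewrite stat -/(m yd) /snr_cost_u /snr_cost_d.
    by field; rewrite ?gt_eqF.
  (* The squared normalised time ratio is exactly the quotient of the two curvatures. *)
  congr (`|_ - 1| < d).
  have := m0 _ yd0; rewrite mE tE -su2 -sd2 => my0.
  by field; rewrite ?gt_eqF.
Qed.

(** * Vanishing of the SNRs as [P0] tends to 0 *)

Lemma min_energy_le (R : realType) (c : constants R) (D' tu tc td : R) :
  admissible c -> 0 <= D' -> 0 < tu -> 0 < td ->
  min_energy c D' tu tc td <=
  D' * (snr_cost_u c * nats_u c * expR (nats_u c * D' / tu) +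
        cpu_cost c * D' ^+ 2 / tc ^+ 2 +
        snr_cost_d c * nats_d c * expR (nats_d c * D' / td)).
Proof.
move=> hc D0 tu0 td0; have [pu pd qu qd cc] := constants_gt0 hc.
have stage p q t : 0 < p -> 0 < q -> 0 < t ->
    stage_energy p q D' t <= D' * (p * q * expR (q * D' / t)).
  move=> p0 q0 t0; rewrite /stage_energy.
  have -> : D' * (p * q * expR (q * D' / t)) =
      p * t * (q * D' / t * expR (q * D' / t)) by field; rewrite gt_eqF.
  by rewrite ler_pM2l ?mulr_gt0//; exact: expR_subr1_le.
have := stage _ _ _ pu qu tu0; have := stage _ _ _ pd qd td0.
rewrite /min_energy.
have -> : cpu_cost c * D' ^+ 3 / tc ^+ 2 =
  D' * (cpu_cost c * D' ^+ 2 / tc ^+ 2) by rewrite exprS; ring.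
lra.
Qed.

(** The nonnegative computing term is dropped; the [y / 4] terms measure the extra cost of a large
    SNR. *)
Lemma min_energy_ge (R : realType) (c : constants R) (D' tu tc td : R)
    (yu := nats_u c * D' / tu) (yd := nats_d c * D' / td) :
  admissible c -> 0 <= D' -> 0 < tu -> 0 < td ->
  D' * (snr_cost_u c * nats_u c * (1 + yu / 4) +
        snr_cost_d c * nats_d c * (1 + yd / 4)) <= min_energy c D' tu tc td.
Proof.
move=> hc D0 tu0 td0; have [pu pd qu qd cc] := constants_gt0 hc.
have stage p q t : 0 < p -> 0 < q -> 0 < t ->
    D' * (p * q * (1 + (q * D' / t) / 4)) <= stage_energy p q D' t.
  move=> p0 q0 t0; rewrite /stage_energy.
  have -> : D' * (p * q * (1 + (q * D' / t) / 4)) =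
      p * t * (q * D' / t * (1 + (q * D' / t) / 4)) by field; rewrite gt_eqF.
  rewrite ler_pM2l ?mulr_gt0//; apply: expR_subr1_ge_quad.
  by rewrite divr_ge0// ?mulr_ge0// ltW.
have := stage _ _ _ pu qu tu0; have := stage _ _ _ pd qd td0.
rewrite /min_energy -/yu -/yd.
have : 0 <= cpu_cost c * D' ^+ 3 / tc ^+ 2.
  by rewrite mulr_ge0 ?invr_ge0 ?sqr_ge0// mulr_ge0 ?exprn_ge0// ltW.
lra.
Qed.

Lemma optimal_ge_near0 (R : realType) (c : constants R) (a : R)
    (A := snr_cost_u c * nats_u c + snr_cost_d c * nats_d c) :
  admissible c -> 0 < a ->
  \forall P0 \near 0^'+, forall x, optimal c P0 x ->
    P0 * Tcyc c < D x * (A * (1 + a)).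
Proof.
move=> hc a0; have [pu pd qu qd cc] := constants_gt0 hc.
have T0 := Tcyc_gt0 hc.
have A0 : 0 < A by rewrite addr_gt0// mulr_gt0.
have Aa0 : 0 < A * (1 + a) by rewrite mulr_gt0// addr_gt0.
(* Chosen so that [k * P0 * (A * (1 + a))] is the whole budget. *)
pose k := Tcyc c / (A * (1 + a)).
pose t := Tcyc c / 3.
have t0 : 0 < t by rewrite divr_gt0.
(* Bound on the energy per unit of [D] at [D = k * P0] with three equal times; it tends to [A], so
   [k * P0] leaves a surplus for small [P0]. *)
pose G (P0 : R) := snr_cost_u c * nats_u c * expR (nats_u c * (k * P0) / t) +
  cpu_cost c * (k * P0) ^+ 2 / t ^+ 2 +
  snr_cost_d c * nats_d c * expR (nats_d c * (k * P0) / t).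
have kcvg : (fun P0 : R => k * P0) @ 0^'+ --> k * 0.
  by apply: cvg_at_right_filter; apply: cvgMr; exact: cvg_id.
have expcvg q : (fun P0 : R => expR (q * (k * P0) / t)) @ 0^'+ -->
    expR (q * (k * 0) / t).
  apply: continuous_cvg; first exact: continuous_expR.
  by apply: cvgMl; exact: cvgMr.
have Gcvg : G P0 @[P0 --> 0^'+] --> G 0.
  apply: cvgD; last by apply: cvgMr.
  apply: cvgD; first by apply: cvgMr.
  apply: cvgMl; apply: cvgMr.
  exact: (cvgM kcvg kcvg).
have G0 : G 0 < A * (1 + a).
  rewrite /G !mulr0 !mul0r expR0 expr0n/= mulr0 mul0r addr0 !mulr1 -/A.
  by rewrite ltr_pMr// ltrDl.
have near1 : \forall P0 \near 0^'+, G P0 < A * (1 + a) /\ 0 < P0.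
  by apply: filterI; [exact: (cvgr_lt _ Gcvg) | exact: nbhs_right_gt].
apply: filterS near1 => P0 [GP P00] x ox.
have k0 : 0 < k by rewrite /k divr_gt0.
have D10 : 0 < k * P0 by rewrite mulr_gt0.
rewrite -ltr_pdivrMr// -(_ : k * P0 = P0 * Tcyc c / (A * (1 + a))); last first.
  by rewrite /k mulrC mulrA.
apply: (optimal_gt hc ox (ltW D10) t0 t0 t0); first by rewrite /t; lra.
apply: le_lt_trans (min_energy_le _ hc (ltW D10) t0 t0) _.
have -> : P0 * Tcyc c = k * P0 * (A * (1 + a)).
  by rewrite /k mulrAC divfK// ?gt_eqF// mulrC.
by rewrite ltr_pM2l.
Qed.

(** Comparing the two bounds on the optimal energy and dividing by [D x] leaves only
    [Au * yu + Ad * yd < 4 * ((Au + Ad) * a)]. *)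
Lemma optimal_snr_small (R : realType) (c : constants R) (e : R) :
  admissible c -> 0 < e ->
  \forall P0 \near 0^'+, forall x,
    optimal c P0 x -> snr_u c x < e /\ snr_d c x < e.
Proof.
move=> hc e0; have [pu pd qu qd cc] := constants_gt0 hc.
set Au := snr_cost_u c * nats_u c; set Ad := snr_cost_d c * nats_d c.
have Au0 : 0 < Au by rewrite mulr_gt0.
have Ad0 : 0 < Ad by rewrite mulr_gt0.
pose l := ln (1 + e).
have l0 : 0 < l by rewrite ln_gt0// ltrDl.
(* Makes [4 * ((Au + Ad) * a)] at most both [l * Au] and [l * Ad], so that [yu] and [yd] fall below
   [l]. *)
pose a := l / 4 * (Au * Ad) / (Au + Ad) ^+ 2.
have s0 : 0 < Au + Ad by rewrite addr_gt0.
have a0 : 0 < a.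
  rewrite /a divr_gt0 ?exprn_gt0//.
  by rewrite (mulr_gt0 (divr_gt0 l0 _) (mulr_gt0 Au0 Ad0)).
have aE : (Au + Ad) * ((Au + Ad) * a) = l / 4 * (Au * Ad).
  by rewrite /a; field; rewrite gt_eqF.
have near1 : \forall P0 \near 0^'+, (forall x, optimal c P0 x ->
    P0 * Tcyc c < D x * ((Au + Ad) * (1 + a))) /\ 0 < P0.
  by apply: filterI; [exact: optimal_ge_near0 | exact: nbhs_right_gt].
apply: filterS near1 => P0 [lower P00] x ox.
have [D0 -> -> W] := optimal_tight hc P00 ox.
case: (ox.1) => _ _ _ tu tc td _ _ _ _ _.
have := le_lt_trans (min_energy_ge (t_c x) hc (ltW D0) tu td).
move: (lower _ ox); rewrite -W => /[swap] /[apply].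
rewrite ltr_pM2l// -/Au -/Ad.
set yu := nats_u c * D x / t_u x; set yd := nats_d c * D x / t_d x => lt_y.
have yu0 : 0 < yu by rewrite /yu divr_gt0// mulr_gt0.
have yd0 : 0 < yd by rewrite /yd divr_gt0// mulr_gt0.
have small y : y < l -> expR y - 1 < e.
  move=> yl; rewrite ltrBlDl -[ltRHS]lnK ?ltr_expR//.
  by rewrite posrE addr_gt0.
have bound : Au * yu + Ad * yd < 4 * ((Au + Ad) * a) by nra.
have [au_le ad_le] : (Au + Ad) * a <= l / 4 * Au /\ (Au + Ad) * a <= l / 4 * Ad.
  by split; rewrite -(ler_pM2l s0) aE; nra.
by split; apply: small; nra.
Qed.

Theorem proposition4 (R : realType) (c : constants R) (hc : admissible c) :
  (forall e : R, 0 < e ->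
     \forall P0 \near 0^'+, forall x : allocation R,
       optimal c P0 x -> snr_u c x < e /\ snr_d c x < e)
  /\
  (forall e : R, 0 < e ->
     exists d : R, 0 < d /\
       forall (P0 : R) (x : allocation R),
         0 < P0 -> optimal c P0 x -> snr_u c x < d -> snr_d c x < d ->
         same_ratio_upto e (E_u x) (E_d x)
           (1 / (rho c * g_u c)) (1 / g_d c)
         /\
         same_ratio_upto e (t_u x) (t_d x)
           (1 / (rho c * Num.sqrt (eta_s c * g_u c)))
           (1 / Num.sqrt (eta_e c * g_d c))).
Proof.
split=> e e0; first exact: optimal_snr_small.
(* The SNR bound is itself the relative error, so [d = e] works. *)
by exists e; split=> // P0 x P00 ox; exact: (optimal_ratios hc P00 ox).
Qed.
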